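(* Let $(G,\mathbf{A})$ be a weighted bipartite torus graph whose associated quiver $\mathcal{Q}_G$ has no 1-cycles, and let $k$ be a quadrilateral face of $G$ whose four sides are distinct. Let $k_1,k_2,k_3,k_4$ be the faces lying across the four sides of $k$, listed in cyclic order around $k$, and suppose $k_i\neq k_{i+1}$ for all $i$ (indices read modulo $4$; opposite faces $k_1,k_3$ or $k_2,k_4$ may coincide). Then the mutation $\mu_k$ of the weighted graph $(G,\mathbf{A})$ is equivalent to the cluster mutation $\mu_k$ of the seed $(\mathbf{A},\mathcal{Q}_G)$: that is, $\mathcal{Q}_{\mu_k(G)}=\mu_k(\mathcal{Q}_G)$, and the face weights of $\mu_k(G)$ are obtained from $\mathbf{A}$ by the cluster mutation in direction $k$ with respect to the quiver $\mathcal{Q}_G$.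
   Context: A torus graph is a graph embedded without crossings in the torus $\mathbb{T}=\mathbb{R}^2/\mathbb{Z}^2$ (faces need not be contractible). It is bipartite if its vertices are colored black and white so that every edge joins vertices of different colors. A weighted bipartite torus graph $(G,\mathbf{A})$ has its faces labeled $1,\dots,n$ and carries a nonzero weight $A_i$ on each face $i$. The quiver $\mathcal{Q}_G$ has one node for each face of $G$; for each edge $e$ of $G$ separating faces $i$ and $j$ there is one arrow between nodes $i$ and $j$, crossing $e$ and oriented so that the black endpoint of $e$ lies on the right of the arrow; afterwards oriented 2-cycles are removed one at a time until none remain (1-cycles, coming from edges with the same face on both sides, may remain). Urban renewal at a quadrilateral face $k$ with four distinct sides: let $u_1,u_2,u_3,u_4$ be the corners of $k$ in cyclic order (alternating colors). Delete the four sides of $k$; add four new vertices $u_1',\dots,u_4'$ inside $k$, with $u_i'$ colored opposite to $u_i$; add edges $u_iu_i'$ and $u_i'u_{i+1}'$ (indices mod 4). The new inner quadrilateral is the new face $k$; the face formerly across side $u_iu_{i+1}$ now contains the region bounded by $u_iu_i'$, $u_i'u_{i+1}'$, $u_{i+1}'u_{i+1}$, and keeps its label. Weights change by $A_k'=(A_{k_1}A_{k_3}+A_{k_2}A_{k_4})/A_k$, all other $A_\ell$ unchanged. Shrinking a 2-valent vertex $v$: delete $v$ and its two edges and identify its two neighbours into a single vertex; weights unchanged. The mutation $\mu_k$ of a weighted bipartite graph at a quadrilateral face $k$ is an urban renewal at $k$ followed by shrinking all 2-valent vertices. Cluster mutation of a seed $(\mathbf{A},\mathcal{Q})$ in direction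 $k$ ($\mathcal{Q}$ without 1- and 2-cycles): $A_k'=A_k^{-1}\big(\prod_{j\to k}A_j+\prod_{k\to j}A_j\big)$ (products over arrows, with multiplicity), $A_i'=A_i$ for $i\ne k$. Quiver mutation at $k$: reverse all arrows at $k$; for each pair of arrows $i\to k\to j$ add an arrow $i\to j$; then remove oriented 2-cycles one by one. *)

(* Defs.v *)
From HB Require Import structures.
From mathcomp Require Import all_boot all_order all_algebra zify.
Set Implicit Arguments.
Unset Strict Implicit.
Unset Printing Implicit Defensive.
Import GRing.Theory.

(* A graph embedded without crossings in a closed oriented surface, with     *)
(* faces labelled by 'I_n, is encoded by its combinatorial map:              *)
(*   dart      : the oriented edges (two for each edge);                     *)
(*   org d     : the vertex at which d starts;                               *)
(*   black v   : the colour of v (false means white);                        *)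
(*   rev d     : the same edge, oriented the other way;                      *)
(*   cw d      : the dart that follows d clockwise around org d;             *)
(*   lface d   : the face on the left of d;                                  *)
(*   genus f   : the genus of the open surface f.                            *)
(* Faces need not be discs: a face may have positive genus, and it may have  *)
(* several boundary walks. An isolated vertex has no dart, so the face that  *)
(* contains it is recorded by vface; the value of vface on the other         *)
(* vertices carries no information.                                          *)
Record surface_graph (n : nat) := SurfaceGraph {
  vert : finType;
  dart : finType;
  black : vert -> bool;
  org : dart -> vert;
  rev : dart -> dart;
  cw : dart -> dart;
  lface : dart -> 'I_n;
  vface : vert -> 'I_n;
  genus : 'I_n -> nat
}.

Section Embedding.
Variables (n : nat) (G : surface_graph n).
Implicit Types (d : dart G) (v : vert G) (f : 'I_n).

(* The side that follows d when one walks along the boundary of the face on  *)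
(* the left of d, keeping that face on the left.                             *)
Definition next_side d : dart G := cw (rev d).

Definition valency v : nat := #|[set d : dart G | org d == v]|.

(* Number of ends of the open surface f: one for each boundary walk, and one *)
(* for each isolated vertex inside f.                                        *)
Definition boundaries f : nat :=
  fcard next_side [pred d : dart G | lface d == f] +
  #|[set v : vert G | (valency v == 0) && (vface v == f)]|.

Definition adjacent : rel 'I_n :=
  fun f g => [exists d : dart G, (lface d == f) && (lface (rev d) == g)].

(* A face of genus g with b boundaries has Euler characteristic 2 - 2g - b,  *)
(* so euler_torus says V - E + \sum_f (2 - 2g(f) - b(f)) = 0. Every vertex   *)
(* is incident to some face, and the faces around a vertex are consecutively *)
(* adjacent, so face_connected says that the surface is connected.           *)
Record torus_graph : Prop := TorusGraph {
  revK : involutive (@rev n G);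
  rev_neq : forall d, rev d != d;
  cw_inj : injective (@cw n G);
  org_cw : forall d d', org d = org d' <-> fconnect (@cw n G) d d';
  lface_next : forall d, lface (next_side d) = lface d;
  face_nonempty : 0 < n;
  face_connected : forall f g, connect adjacent f g;
  euler_torus :
    #|vert G| + 2 * n = #|dart G|./2 + \sum_f (2 * genus G f + boundaries f)
}.

Definition bipartite : Prop := forall d, black (org (rev d)) = ~~ black (org d).

(* A disc bounded by one closed walk with four sides. *)
Definition quadrilateral f : Prop :=
  [/\ genus G f = 0, boundaries f = 1 & #|[set d : dart G | lface d == f]| = 4].

Definition distinct_sides f : Prop :=
  forall d d' : dart G, lface d = f -> lface d' = f -> d' != rev d.

(* For a quadrilateral face with first side d, side d i runs from corner d i *)
(* to corner d (i + 1), and across d i is the face beyond it. Indices live   *)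
(* in 'I_4, whose addition is modulo 4.                                      *)
Definition side d (i : 'I_4) : dart G := iter i next_side d.
Definition corner d (i : 'I_4) : vert G := org (side d i).
Definition across d (i : 'I_4) : 'I_n := lface (rev (side d i)).

End Embedding.

(* Quivers on 'I_n: Q i j is the number of arrows i -> j. *)
Section Quivers.
Variable n : nat.
Implicit Types Q : 'M[nat]_n.

Definition remove_2cycles Q : 'M[nat]_n :=
  \matrix_(i, j) if i == j then Q i i else Q i j - Q j i.

Definition is_2cycle Q (i j : 'I_n) : bool :=
  [&& i != j, 0 < Q i j & 0 < Q j i].

Definition remove_2cycle Q (i j : 'I_n) : 'M[nat]_n :=
  \matrix_(a, b) (Q a b - (((a, b) == (i, j)) || ((a, b) == (j, i)))).

(* By the next three lemmas, removing oriented 2-cycles one at a time, in    *)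
(* any order, until none remain ends in remove_2cycles Q.                    *)
Lemma remove_2cycles_step Q i j :
  is_2cycle Q i j -> remove_2cycles (remove_2cycle Q i j) = remove_2cycles Q.
Proof.
case/and3P=> ij Qij Qji; apply/matrixP=> a b; rewrite !mxE !xpair_eqE.
have [->|ab] := eqVneq a b.
  have [->|] := eqVneq b i; first by rewrite (negPf ij) subn0.
  by rewrite andbF subn0.
have [Ea|Ea] := eqVneq a i; have [Eb|Eb] := eqVneq b j;
  have [Ea'|Ea'] := eqVneq a j; have [Eb'|Eb'] := eqVneq b i;
  subst; rewrite ?eqxx //= ?subn0 //; try by rewrite eqxx in ij.
all: lia.
Qed.

Lemma remove_2cycles_id Q :
  (forall i j, ~~ is_2cycle Q i j) -> remove_2cycles Q = Q.
Proof.
move=> noQ; apply/matrixP=> a b; rewrite !mxE.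
have [->//|ab] := eqVneq a b.
by have := noQ a b; rewrite /is_2cycle ab /=; lia.
Qed.

Lemma remove_2cycles_none Q i j : ~~ is_2cycle (remove_2cycles Q) i j.
Proof.
rewrite /is_2cycle !mxE (eq_sym j i).
by case: (i == j) => //=; lia.
Qed.

Definition has_1cycle Q : Prop := exists i, 0 < Q i i.

Definition quiver_mutation (k : 'I_n) Q : 'M[nat]_n :=
  remove_2cycles
    (\matrix_(i, j) if (i == k) || (j == k) then Q j i
                    else Q i j + Q i k * Q k j).

Definition seed (K : fieldType) : Type := ({ffun 'I_n -> K} * 'M[nat]_n)%type.

Definition seed_mutation (K : fieldType) (k : 'I_n) (s : seed K) : seed K :=
  let: (A, Q) := s in
  ([ffun i => if i == k then
      ((A k)^-1 * (\prod_j A j ^+ Q j k + \prod_j A j ^+ Q k j))%R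
    else A i],
   quiver_mutation k Q).

End Quivers.

(* A dart d with a black origin stands for its edge; the arrow that crosses  *)
(* this edge from the left of d to its right has the black end on its right. *)
Definition quiver n (G : surface_graph n) : 'M[nat]_n :=
  remove_2cycles
    (\matrix_(i, j)
      #|[set d : dart G | [&& black (org d), lface d == i & lface (rev d) == j]]|).

(* The darts created at the i-th corner u_i by an urban renewal:             *)
(*   SpokeOut : u_i -> u_i'            SpokeIn : u_i' -> u_i                 *)
(*   RimFwd : u_i' -> u_(i+1)'         RimBwd : u_(i+1)' -> u_i'             *)
Variant new_dart := SpokeOut | SpokeIn | RimFwd | RimBwd.

Definition new_dart_code (t : new_dart) : bool * bool :=
  match t with
  | SpokeOut => (true, true) | SpokeIn => (true, false)
  | RimFwd => (false, true) | RimBwd => (false, false)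
  end.
Definition new_dart_decode (c : bool * bool) : new_dart :=
  match c with
  | (true, true) => SpokeOut | (true, false) => SpokeIn
  | (false, true) => RimFwd | (false, false) => RimBwd
  end.
Lemma new_dart_codeK : cancel new_dart_code new_dart_decode.
Proof. by case. Qed.
HB.instance Definition _ := Finite.copy new_dart (can_type new_dart_codeK).

(* Urban renewal at the quadrilateral face lface d, whose first side is d.   *)
Section UrbanRenewal.
Local Open Scope ring_scope.
Variables (n : nat) (G : surface_graph n) (d : dart G).

Definition is_side (x : dart G) : bool :=
  [exists i, (x == side d i) || (x == rev (side d i))].

Definition ur_vert : finType := (vert G + 'I_4)%type.
Definition ur_dart : finType := ({x : dart G | ~~ is_side x} + new_dart * 'I_4)%type.

Definition ur_black (v : ur_vert) : bool :=
  match v with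
  | inl v => black v
  | inr i => ~~ black (corner d i)
  end.

Definition ur_org (x : ur_dart) : ur_vert :=
  match x with
  | inl x => inl (org (val x))
  | inr (SpokeOut, i) => inl (corner d i)
  | inr (SpokeIn, i) => inr i
  | inr (RimFwd, i) => inr i
  | inr (RimBwd, i) => inr (i + 1)
  end.

Definition ur_rev (x : ur_dart) : ur_dart :=
  match x with
  | inl x => inl (insubd x (rev (val x)))
  | inr (SpokeOut, i) => inr (SpokeIn, i)
  | inr (SpokeIn, i) => inr (SpokeOut, i)
  | inr (RimFwd, i) => inr (RimBwd, i)
  | inr (RimBwd, i) => inr (RimFwd, i)
  end.

(* Clockwise around corner d i, the deleted darts rev (side d (i - 1)) and   *)
(* side d i are consecutive, with the corner of the face between them; the   *)
(* spoke u_i -> u_i' takes their place. A dart y that follows a surviving    *)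
(* dart or side d i is therefore a survivor or some rev (side d (i - 1)).    *)
Definition ur_enter (y : dart G) : ur_dart :=
  if insub y is Some x then inl x
  else inr (SpokeOut, odflt 0 [pick i | y == rev (side d (i - 1))]).

Definition ur_cw (x : ur_dart) : ur_dart :=
  match x with
  | inl x => ur_enter (cw (val x))
  | inr (SpokeOut, i) => ur_enter (cw (side d i))
  | inr (SpokeIn, i) => inr (RimBwd, i - 1)
  | inr (RimFwd, i) => inr (SpokeIn, i)
  | inr (RimBwd, i) => inr (RimFwd, i + 1)
  end.

Definition ur_lface (x : ur_dart) : 'I_n :=
  match x with
  | inl x => lface (val x)
  | inr (SpokeOut, i) => across d (i - 1)
  | inr (SpokeIn, i) => across d i
  | inr (RimFwd, i) => lface d
  | inr (RimBwd, i) => across d i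
  end.

(* The new vertices are not isolated, so their vface is irrelevant. *)
Definition ur_vface (v : ur_vert) : 'I_n :=
  match v with
  | inl v => vface v
  | inr _ => lface d
  end.

Definition urban_renewal : surface_graph n :=
  @SurfaceGraph n ur_vert ur_dart ur_black ur_org ur_rev ur_cw ur_lface
    ur_vface (@genus n G).

Definition urban_weights (K : fieldType) (A : {ffun 'I_n -> K}) :
    {ffun 'I_n -> K} :=
  [ffun f => if f == lface d then
      (A (across d 0) * A (across d 2%:R) + A (across d 1) * A (across d 3%:R))
        / A (lface d)
    else A f].

End UrbanRenewal.

(* The vertex org e can be shrunk when it is 2-valent, its two darts being e *)
(* and cw e, and the other ends of its edges are two vertices to identify.   *)
(* If both edges lead to the same vertex there is nothing to identify, and   *)
(* deleting the edges would merge two faces: such a vertex is left alone.    *)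
Definition shrinkable n (G : surface_graph n) (e : dart G) : bool :=
  let v := org e in
  let w1 := org (rev e) in
  let w2 := org (rev (cw e)) in
  [&& valency v == 2, w1 != v, w2 != v & w1 != w2].

Section Shrink.
Variables (n : nat) (G : surface_graph n) (e : dart G).
Hypothesis He : shrinkable e.

Let v := org e.
Let w1 := org (rev e).
Let w2 := org (rev (cw e)).

(* The vertex obtained by identifying w1 with w2 is represented by w1. *)
Definition sh_vert : finType := {x : vert G | (x != v) && (x != w2)}.
Definition sh_dart : finType :=
  {x : dart G | (org x != v) && (org (rev x) != v)}.

Definition sh_merge (x : vert G) : vert G := if x == w2 then w1 else x.

Lemma sh_mergeP x : x != v -> (sh_merge x != v) && (sh_merge x != w2).
Proof.
case/and4P: He => _ w1v w2v w12 xv; rewrite /sh_merge.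
by case: (boolP (x == w2)) => [_|xw2]; apply/andP; split.
Qed.

Lemma sh_dart_org (x : sh_dart) : org (val x) != v.
Proof. by case/andP: (valP x). Qed.

Definition sh_org (x : sh_dart) : sh_vert :=
  exist _ (sh_merge (org (val x))) (sh_mergeP (sh_dart_org x)).

(* The edges e and cw e are contracted: a walk around w1 that meets the      *)
(* deleted dart rev e goes on around w2 after rev (cw e), and conversely.    *)
(* Two jumps are needed when w1 or w2 has no other dart.                     *)
Definition sh_jump (y : dart G) : dart G :=
  if y == rev e then cw (rev (cw e))
  else if y == rev (cw e) then cw (rev e)
  else y.

Definition sh_cw (x : sh_dart) : sh_dart :=
  insubd x (sh_jump (sh_jump (cw (val x)))).

(* The merged vertex is isolated if w1 and w2 had no other edge, and then it *)
(* lies in the face around the deleted path, which is lface e.               *)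
Definition shrink : surface_graph n :=
  @SurfaceGraph n sh_vert sh_dart
    (fun x => black (val x))
    sh_org
    (fun x => insubd x (rev (val x)))
    sh_cw
    (fun x => lface (val x))
    (fun x => if val x == w1 then lface e else vface (val x))
    (@genus n G).

End Shrink.

(* shrink_all G G': G' results from shrinking 2-valent vertices of G, one    *)
(* after the other and in any order, until no vertex can be shrunk.          *)
Inductive shrink_all n : surface_graph n -> surface_graph n -> Prop :=
| ShrinkDone (G : surface_graph n) :
    (forall e : dart G, ~~ shrinkable e) -> shrink_all G G
| ShrinkStep (G : surface_graph n) (e : dart G) (He : shrinkable e)
    (G' : surface_graph n) :
    shrink_all (shrink He) G' -> shrink_all G G'.

Lemma card_shrink n (G : surface_graph n) (e : dart G) (He : shrinkable e) :
  #|vert (shrink He)| < #|vert G|.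
Proof.
rewrite card_sig; apply: proper_card; apply/properP; split.
  exact/subsetP.
by exists (org e); rewrite // inE eqxx.
Qed.

Lemma shrink_all_exists n (G : surface_graph n) : exists G', shrink_all G G'.
Proof.
have [m] := ubnP #|vert G|; elim: m G => // m IHm G; rewrite ltnS => leGm.
have [/existsP[e He]|noe] := boolP [exists e : dart G, shrinkable e].
  have [G' HG'] := IHm _ (leq_trans (card_shrink He) leGm).
  by exists G'; apply: ShrinkStep HG'.
by exists G; apply: ShrinkDone => e; apply: contra noe => He; apply/existsP; exists e.
Qed.

(* (G', A') is a mutation of (G, A) at the face k. The side d at which the   *)
(* numbering of the sides of k starts is arbitrary.                          *)
Definition graph_mutation n (K : fieldType) (k : 'I_n)
    (G : surface_graph n) (A : {ffun 'I_n -> K})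
    (G' : surface_graph n) (A' : {ffun 'I_n -> K}) : Prop :=
  exists d : dart G,
    [/\ lface d = k, shrink_all (urban_renewal d) G' & A' = urban_weights d A].

(* Main.v *)
(** Write q(i,j) for the number of edges whose black end is to the right of a
    crossing from i to j; away from the diagonal the quiver only depends on
    q(i,j) - q(j,i). Around the quadrilateral k the colours alternate, so the
    arrows at k alternately leave and enter it. If B f and W f count the black
    and the white corners whose next side borders f, then q(k,f) = B f and
    q(f,k) = W f. Consecutive neighbours differ, hence W f * B f = 0: no 2-cycle
    at k hides an arrow. Urban renewal exchanges the roles of B and W at k, and
    its four spokes contribute exactly W i * B j to q(i,j), one for each path
    i -> k -> j. Shrinking a 2-valent vertex deletes two edges that carry
    opposite arrows, so it does not change the quiver. *)
From mathcomp Require Import all_boot all_order all_algebra zify.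
Require Import Defs.
Set Implicit Arguments.
Unset Strict Implicit.
Unset Printing Implicit Defensive.
Import GRing.Theory.

(** * Bipartite maps and arrow counts before cancellation of 2-cycles *)

(* Unlike torus_graph, this does not ask that cw act transitively around each
   vertex: at a shrinkable vertex that follows from w1 != w2. *)
Record bipartite_map n (G : surface_graph n) : Prop := BipartiteMap {
  bm_revK : involutive (@rev n G);
  bm_cw_inj : injective (@cw n G);
  bm_org_cw : forall x : dart G, org (cw x) = org x;
  bm_lface_cw : forall x : dart G, lface (cw x) = lface (rev x);
  bm_bipartite : bipartite G
}.

Lemma torus_graph_bipartite_map n (G : surface_graph n) :
  torus_graph G -> bipartite G -> bipartite_map G.
Proof.
case=> rK _ cI oC lN _ _ _ bG; split=> // x.
  by apply/esym/oC; apply: fconnect1.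
by rewrite -(lN (rev x)) /next_side rK.
Qed.

Lemma bm_rev_inj n (G : surface_graph n) : bipartite_map G -> injective (@rev n G).
Proof. by move/bm_revK/inv_inj. Qed.

Definition is_arrow n (G : surface_graph n) (i j : 'I_n) (x : dart G) : bool :=
  [&& black (org x), lface x == i & lface (rev x) == j].

(** A sum of indicators, so that it splits along any decomposition of the darts. *)
Definition arrows n (G : surface_graph n) : 'M[nat]_n :=
  \matrix_(i, j) \sum_(x : dart G) (is_arrow i j x : nat).

Lemma remove_2cyclesE n (Q : 'M[nat]_n) i j :
  remove_2cycles Q i j = if i == j then Q i i else Q i j - Q j i.
Proof. by rewrite mxE. Qed.

Lemma quiverE n (G : surface_graph n) : quiver G = remove_2cycles (arrows G).
Proof.
congr remove_2cycles; apply/matrixP=> i j; rewrite !mxE cardsE -sum1_card.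
rewrite big_mkcond; apply: eq_bigr => x _; rewrite unfold_in.
by rewrite -/(is_arrow i j x); case: is_arrow.
Qed.

Lemma sum_subtype (T : finType) (P : pred T) (F : T -> nat) :
  \sum_x F x = \sum_(x : {x | P x}) F (val x) + \sum_(x | ~~ P x) F x.
Proof.
rewrite (bigID P) /=; congr (_ + _).
rewrite (reindex_omap (fun x : {x | P x} => val x) insub) /=.
  by apply: eq_bigl => x; rewrite valK eqxx (valP x).
by move=> x Px; rewrite insubT.
Qed.

Lemma no_1cycleP n (Q : 'M[nat]_n) : ~ has_1cycle Q <-> forall i, Q i i = 0.
Proof.
split=> [noQ i|Q0 [i]]; last by rewrite Q0.
by apply/eqP; rewrite -leqn0 leqNgt; apply/negP=> Qi; apply: noQ; exists i.
Qed.

(** * Shrinking one 2-valent vertex *)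

Section Shrink.
Variables (n : nat) (G : surface_graph n) (e : dart G).
Hypotheses (bmG : bipartite_map G) (He : shrinkable e).
Let v := org e.
Let p1 := rev e.
Let p2 := rev (cw e).

Let rK : involutive (@rev n G). Proof. exact: bm_revK bmG. Qed.
Let cI : injective (@cw n G). Proof. exact: bm_cw_inj bmG. Qed.
Let oC (x : dart G) : org (cw x) = org x. Proof. exact: (bm_org_cw bmG). Qed.
Let lC (x : dart G) : lface (cw x) = lface (rev x). Proof. exact: (bm_lface_cw bmG). Qed.
Let bG (x : dart G) : black (org (rev x)) = ~~ black (org x).
Proof. exact: (bm_bipartite bmG). Qed.

Let w12 : org p1 != org p2. Proof. by case/and4P: He. Qed.
Let w1v : org p1 != v. Proof. by case/and4P: He. Qed.
Let w2v : org p2 != v. Proof. by case/and4P: He. Qed.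

Let p12 : p1 != p2. Proof. by apply: contraNneq w12 => ->. Qed.

Lemma shrinkable_cw_neq : cw e != e.
Proof. by apply: contraNneq w12 => E; rewrite /p2 E. Qed.

Lemma shrinkable_darts (x : dart G) : (org x == v) = (x == e) || (x == cw e).
Proof.
case/and4P: He => /eqP card2 _ _ _.
have E : [set e; cw e] = [set x : dart G | org x == v].
  apply/eqP; rewrite eqEcard cards2 eq_sym shrinkable_cw_neq [#|_|]card2 andbT.
  by apply/subsetP=> y /set2P[->|->]; rewrite inE ?oC.
by have := in_set2 x e (cw e); rewrite E inE.
Qed.

Lemma shrinkable_cwK : cw (cw e) = e.
Proof.
have: org (cw (cw e)) == v by rewrite !oC.
rewrite shrinkable_darts => /orP[/eqP //|/eqP/cI E].
by case/eqP: shrinkable_cw_neq.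
Qed.

(** The edges of [e] and [cw e] separate the same two faces, with left and right exchanged. *)
Let l1 : lface p1 = lface (cw e). Proof. by rewrite lC. Qed.
Let l2 : lface p2 = lface e. Proof. by rewrite -[in RHS]shrinkable_cwK lC. Qed.

Let surv (x : dart G) := (org x != v) && (org (rev x) != v).

Lemma shrink_deletedE (x : dart G) : org x != v -> ~~ surv x = (x == p1) || (x == p2).
Proof.
move=> xv; rewrite /surv xv /= negbK shrinkable_darts.
by rewrite -!(inj_eq (bm_rev_inj bmG) (rev x)) rK.
Qed.

Lemma surv_neq (x : dart G) : surv x -> x != p1 /\ x != p2.
Proof.
move=> sx; have /andP[xv _] := sx.
by apply/andP; rewrite -negb_or -shrink_deletedE ?negbK.
Qed.

Let jump (x : dart G) := sh_jump e (sh_jump e (cw x)).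

(* In Jump2 and Jump4 the neighbour reached first has no surviving dart. *)
Variant jump_spec (x : dart G) : dart G -> Prop :=
| Jump0 of cw x != p1 & cw x != p2 : jump_spec x (cw x)
| Jump1 of cw x = p1 & cw p2 != p2 : jump_spec x (cw p2)
| Jump2 of cw x = p1 & cw p2 = p2 : jump_spec x (cw p1)
| Jump3 of cw x = p2 & cw p1 != p1 : jump_spec x (cw p1)
| Jump4 of cw x = p2 & cw p1 = p1 : jump_spec x (cw p2).

Lemma jumpP (x : dart G) : surv x -> jump_spec x (jump x).
Proof.
move=> sx; have [xp1 xp2] := surv_neq sx.
have p21 : (p2 == p1) = false by apply/negbTE; rewrite eq_sym.
rewrite /jump /sh_jump -/p1 -/p2.
have [E1|N1] := eqVneq (cw x) p1; last first.
  have [E2|N2] := eqVneq (cw x) p2; last by rewrite (negPf N1) (negPf N2); apply: Jump0.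
  have [E|N] := eqVneq (cw p1) p1; first exact: Jump4.
  have [E'|_] := eqVneq (cw p1) p2; last exact: Jump3.
  (* Here [cw x] and [cw p1] would both be [p2], although [x] survives. *)
  by case/eqP: xp1; apply: cI; rewrite E2 E'.
have N : cw p2 != p1 by apply: contraNneq xp2 => E; apply/eqP/cI; rewrite E E1.
rewrite (negPf N); have [E|N'] := eqVneq (cw p2) p2; first exact: Jump2.
exact: Jump1.
Qed.

(** Two jumps suffice: [cw] keeps the origin, so it never sends [p1] to [p2] or back, and if it
    fixes one of them, injectivity keeps [cw x] away from that one. *)
Lemma surv_jump (x : dart G) : surv x -> surv (jump x).
Proof.
move=> sx; have /andP[xv _] := sx.
have [xp1 xp2] := surv_neq sx.
have keep y : org y != v -> y != p1 -> y != p2 -> surv y.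
  by move=> yv y1 y2; rewrite -[surv y]negbK shrink_deletedE // negb_or y1.
have N12 : cw p1 = p2 -> org p1 = org p2 by move <-; rewrite oC.
have N21 : cw p2 = p1 -> org p1 = org p2 by move <-; rewrite oC.
case: jumpP => // H1 H2; apply: keep; rewrite ?oC //.
- by apply: contraNneq w12 => /N21->.
- by apply: contraNneq xp1 => E; apply/eqP/cI; rewrite H1 E.
- by apply: contraNneq w12 => /N12->.
- by apply: contraNneq w12 => /N12->.
- by apply: contraNneq w12 => /N21->.
- by apply: contraNneq xp2 => E; apply/eqP/cI; rewrite H1 E.
Qed.

Lemma jump_inj (x y : dart G) : surv x -> surv y -> jump x = jump y -> x = y.
Proof.
move=> sx sy; have [/eqP x1 /eqP x2] := surv_neq sx.
have [/eqP y1 /eqP y2] := surv_neq sy.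
have p12' := elimN eqP p12.
(* These four facts exclude the collisions of [Jump1] with [Jump4] and of [Jump2] with [Jump3],
   where cancelling [cw] yields only a trivial equation. *)
have nx1 : cw x = p1 -> cw p1 <> p1 by move=> E F; apply/x1/cI; rewrite E F.
have nx2 : cw x = p2 -> cw p2 <> p2 by move=> E F; apply/x2/cI; rewrite E F.
have ny1 : cw y = p1 -> cw p1 <> p1 by move=> E F; apply/y1/cI; rewrite E F.
have ny2 : cw y = p2 -> cw p2 <> p2 by move=> E F; apply/y2/cI; rewrite E F.
have xy : cw x = cw y -> x = y by apply: cI.
case: (jumpP sx) => [_ _|Ex Nx|Ex Fx|Ex Nx|Ex Fx];
case: (jumpP sy) => [_ _|Ey Ny|Ey Fy|Ey Ny|Ey Fy] /cI Exy //;
  try (by apply: xy; rewrite Ex Ey);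
by [case: x1 | case: x2 | case: y1 | case: y2
   | case: (nx1 Ex) | case: (nx2 Ex) | case: (ny1 Ey) | case: (ny2 Ey)].
Qed.

Lemma merge_jump (x : dart G) : surv x ->
  sh_merge e (org (jump x)) = sh_merge e (org x).
Proof.
have m1 : sh_merge e (org p1) = org p1 by rewrite /sh_merge (negPf w12).
have m2 : sh_merge e (org p2) = org p1 by rewrite /sh_merge eqxx.
by move/jumpP; case=> E _; rewrite -(oC x) ?E ?oC ?m1 ?m2.
Qed.

Lemma lface_jump (x : dart G) : surv x -> lface (jump x) = lface (rev x).
Proof.
have c1 : lface (cw p1) = lface e by rewrite lC rK.
have c2 : lface (cw p2) = lface (cw e) by rewrite lC rK.
move/jumpP; case=> [_ _|E _|E F|E _|E F]; rewrite -(lC x) ?E ?l1 ?l2 ?c1 ?c2 //.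
  (* When [cw] fixes [p2], both sides of its edge lie in one face, so the two faces at [v]
     coincide. *)
  by rewrite -l2 -c2 F.
by rewrite -l1 -c1 F.
Qed.

Let surv_rev (x : dart G) : surv (rev x) = surv x.
Proof. by rewrite /surv rK andbC. Qed.

Lemma val_shrink_rev (x : dart (shrink He)) : val (rev x) = rev (val x).
Proof. by rewrite val_insubd -/(surv _) surv_rev /surv (valP x). Qed.

Lemma val_shrink_cw (x : dart (shrink He)) : val (cw x) = jump (val x).
Proof.
by rewrite val_insubd -/(surv _) -/(jump (val x)) surv_jump //; apply: (valP x).
Qed.

Lemma bipartite_map_shrink : bipartite_map (shrink He).
Proof.
split.
- by move=> x; apply: val_inj; rewrite !val_shrink_rev rK.
- move=> x y /(congr1 val); rewrite !val_shrink_cw => E.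
  by apply: val_inj; apply: jump_inj E; apply: valP.
- move=> x; apply: val_inj.
  change (sh_merge e (org (val (cw x))) = sh_merge e (org (val x))).
  by rewrite val_shrink_cw; apply: merge_jump (valP x).
- move=> x; change (lface (val (cw x)) = lface (val (rev x))).
  by rewrite val_shrink_cw val_shrink_rev; apply: lface_jump (valP x).
- move=> x; rewrite /= val_shrink_rev.
  (* Both neighbours have the colour opposite to that of [v]. *)
  have bM y : black (sh_merge e y) = black y.
    by rewrite /sh_merge; case: eqP => // ->; rewrite !bG oC.
  by rewrite !bM bG.
Qed.

(** Of the four deleted darts only those with a black origin count: [e] and [cw e] if [v] is black,
    [p1] and [p2] otherwise. Either pair gives one arrow in each direction. *)
Lemma arrows_shrink (i j : 'I_n) :
  arrows G i j = arrows (shrink He) i j +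
    (((lface e == i) && (lface (cw e) == j)) + ((lface (cw e) == i) && (lface e == j))).
Proof.
rewrite !mxE (sum_subtype surv); congr (_ + _).
  apply: eq_bigr => x _; rewrite /is_arrow /= val_shrink_rev.
  congr (nat_of_bool (_ && _)); rewrite /sh_merge; case: eqP => // ->.
  by rewrite !bG oC.
rewrite (eq_bigl (mem [:: e; cw e; p1; p2])) => [|x]; last first.
  rewrite !inE /= orbA; have [xv|xv] := boolP (org x == v).
    by rewrite /surv xv -shrinkable_darts xv.
  by rewrite shrink_deletedE // -shrinkable_darts (negPf xv).
rewrite -big_uniq /=; last first.
  rewrite !inE !negb_or eq_sym shrinkable_cw_neq p12 /= !andbT.
  have N y z : org y = v -> org z != v -> y != z.
    by move=> yv; apply: contraNneq => <-; apply/eqP.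
  by rewrite !N ?oC.
rewrite !big_cons big_nil /is_arrow !rK -/p1 -/p2 !bG !oC l1 l2.
by case: (black _); rewrite /= ?add0n ?addn0 // addnC.
Qed.

(** The correction in [arrows_shrink] is symmetric in [i] and [j], so it cancels off the diagonal.
    On the diagonal nothing cancels, but there the hypothesis makes every summand zero. *)
Lemma quiver_shrink : (forall i, quiver G i i = 0) -> quiver (shrink He) = quiver G.
Proof.
rewrite !quiverE => Q0; apply/matrixP=> i j; move: (Q0 i).
rewrite !remove_2cyclesE eqxx !arrows_shrink.
have [_ /eqP|_ _] := eqVneq i j; first by rewrite addn_eq0 => /andP[/eqP-> /eqP->].
by rewrite [X in _ - (_ + X)]addnC ![(_ == j) && _]andbC subnDr.
Qed.

End Shrink.

Lemma quiver_shrink_all n (G G' : surface_graph n) :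
  bipartite_map G -> (forall i, quiver G i i = 0) -> shrink_all G G' ->
  quiver G' = quiver G.
Proof.
move=> bmG Q0 GG'; elim: GG' bmG Q0 => // {}G e He {}G' _ IH bmG Q0.
have E := quiver_shrink bmG He Q0.
by rewrite IH ?E //; apply: bipartite_map_shrink.
Qed.

(** * Cyclic indices modulo 4 *)

Lemma big_ord4 (R : Type) (idx : R) (op : Monoid.law idx) (F : 'I_4 -> R) :
  \big[op/idx]_(i < 4) F i =
  op (F 0%R) (op (F 1%R) (op (F 2%:R%R) (F 3%:R%R))).
Proof.
rewrite !big_ord_recl big_ord0 Monoid.mulm1.
by congr (op (F _) (op (F _) (op (F _) (F _)))); apply: val_inj.
Qed.

Lemma ord4P (P : 'I_4 -> Prop) :
  P 0%R -> P 1%R -> P 2%:R%R -> P 3%:R%R -> forall i, P i.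
Proof.
move=> P0 P1 P2 P3 [[|[|[|[|i]]]] //= lti].
- by congr (P _) : P0; apply: val_inj.
- by congr (P _) : P1; apply: val_inj.
- by congr (P _) : P2; apply: val_inj.
- by congr (P _) : P3; apply: val_inj.
Qed.

Lemma quiver_mutationE n (k : 'I_n) (Q : 'M[nat]_n) i j :
  let M i j := if (i == k) || (j == k) then Q j i else Q i j + Q i k * Q k j in
  quiver_mutation k Q i j = if i == j then M i i else M i j - M j i.
Proof. by rewrite remove_2cyclesE !mxE. Qed.

(** * The boundary walk of the quadrilateral face *)

Section Quadrilateral.
Variables (n : nat) (G : surface_graph n).
Hypothesis bmG : bipartite_map G.
Variable d : dart G.
Let k := lface d.
Hypotheses (quad : quadrilateral G k) (dist : distinct_sides G k).

Let rK : involutive (@rev n G). Proof. exact: bm_revK bmG. Qed.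
Let cI : injective (@cw n G). Proof. exact: bm_cw_inj bmG. Qed.
Let oC (x : dart G) : org (cw x) = org x. Proof. exact: (bm_org_cw bmG). Qed.
Let lC (x : dart G) : lface (cw x) = lface (rev x). Proof. exact: (bm_lface_cw bmG). Qed.
Let bG (x : dart G) : black (org (rev x)) = ~~ black (org x).
Proof. exact: (bm_bipartite bmG). Qed.

Let next_inj : injective (@next_side n G).
Proof. by move=> x y /cI/(bm_rev_inj bmG). Qed.

Lemma lface_next_side (x : dart G) : lface (next_side x) = lface x.
Proof. by rewrite lC rK. Qed.

Lemma lface_fconnect (x y : dart G) : fconnect (@next_side n G) x y -> lface y = lface x.
Proof.
move/iter_findex<-; elim: (findex _ x y) => //= m <-.
exact: lface_next_side.
Qed.

(** The first summand of [boundaries] counts the roots of the [next_side] orbits in the face. It is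
    at most 1, so the orbit of [d] contains every side. *)
Lemma quad_fconnect (x : dart G) : (lface x == k) = fconnect (@next_side n G) d x.
Proof.
have sym := fconnect_sym next_inj.
have in_roots y : lface y = k ->
    froot (@next_side n G) y \in [predI froots (@next_side n G) & [pred z | lface z == k]].
  move=> yk; apply/andP; split; first exact: roots_root.
  by rewrite /= inE (lface_fconnect (connect_root _ y)) yk.
apply/eqP/idP=> [xk|]; last exact: lface_fconnect.
rewrite -(root_connect sym).
case: quad => _ b1 _; apply/eqP.
suff /card_le1_eqP roots1 :
    #|[predI froots (@next_side n G) & [pred z | lface z == k]]| <= 1.
  by apply: roots1; apply: in_roots.
by rewrite -b1 leq_addr.
Qed.

Lemma quad_order : order (@next_side n G) d = 4.
Proof.
case: quad => _ _ <-; rewrite cardsE; apply: eq_card => x.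
by rewrite !inE -quad_fconnect.
Qed.

Lemma iter4_next_side : iter 4 (@next_side n G) d = d.
Proof. by rewrite -quad_order iter_order. Qed.

Lemma side_inj : injective (@side n G d).
Proof.
move=> i j /(congr1 (findex (@next_side n G) d)); rewrite /side.
by rewrite !findex_iter ?quad_order // => /val_inj.
Qed.

Lemma sideP (x : dart G) : lface x = k -> exists i, x = side d i.
Proof.
move/eqP; rewrite quad_fconnect => dx.
have := findex_max dx; rewrite quad_order => lt4.
by exists (Ordinal lt4); rewrite /side /= iter_findex.
Qed.

Lemma lface_side i : lface (side d i) = k.
Proof. exact: lface_fconnect (fconnect_iter _ _ _). Qed.

Lemma side_next i : side d (i + 1)%R = next_side (side d i).
(* Only the last index wraps around; the others hold by computation. *)
Proof. by elim/ord4P: i => //; rewrite [RHS]iter4_next_side. Qed.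

Lemma side_rev_neq i j : rev (side d j) != side d i.
Proof. by rewrite eq_sym dist ?lface_side. Qed.

Lemma sideS i : cw (rev (side d i)) = side d (i + 1)%R.
Proof. by rewrite side_next. Qed.

Lemma corner_next i : corner d (i + 1)%R = org (rev (side d i)).
Proof. by rewrite /corner -sideS oC. Qed.

Lemma black_corner_next i : black (corner d (i + 1)%R) = ~~ black (corner d i).
Proof. by rewrite corner_next bG. Qed.

Lemma is_side_rev (x : dart G) : is_side d (rev x) = is_side d x.
Proof.
by apply: eq_existsb => i; rewrite orbC (inj_eq (bm_rev_inj bmG)) (can2_eq rK rK).
Qed.

(** * Urban renewal yields a bipartite map *)

Lemma ur_enter_survivor (y : dart G) (sy : ~~ is_side d y) :
  ur_enter d y = inl (exist _ y sy).
Proof. by rewrite /ur_enter insubT. Qed.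

Lemma ur_enter_side i : ur_enter d (rev (side d i)) = inr (SpokeOut, (i + 1)%R).
Proof.
rewrite /ur_enter insubN; last first.
  by rewrite negbK; apply/existsP; exists i; rewrite eqxx orbT.
case: pickP => [j|/(_ (i + 1)%R)]; last by rewrite addrK eqxx.
by rewrite (inj_eq (bm_rev_inj bmG)) (inj_eq side_inj) => /eqP->; rewrite subrK.
Qed.

Variant enter_spec (y : dart G) : ur_dart d -> Prop :=
| EnterSurvivor (sy : ~~ is_side d y) : enter_spec y (inl (exist _ y sy))
| EnterSide i of y = rev (side d i) : enter_spec y (inr (SpokeOut, (i + 1)%R)).

(** The default index in [ur_enter] is reached only when [y] is itself some [side d i], which the
    hypothesis excludes. *)
Lemma ur_enterP (y : dart G) : (forall i, y <> side d i) -> enter_spec y (ur_enter d y).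
Proof.
move=> Ny; have [/existsP[i /orP[/eqP/Ny//|/eqP Ey]]|sy] := boolP (is_side d y).
  by rewrite Ey ur_enter_side -Ey; apply: EnterSide.
by rewrite (ur_enter_survivor sy); apply: EnterSurvivor.
Qed.

(** By [sideS], the only dart that [cw] sends to a side is the reverse of the preceding side, which
    has been deleted. *)
Lemma cw_survivor_not_side (x : dart G) i : ~~ is_side d x -> cw x <> side d i.
Proof.
move=> + E; have {}E : x = rev (side d (i - 1)%R) by apply: cI; rewrite sideS subrK.
by case/existsP; exists (i - 1)%R; rewrite E eqxx orbT.
Qed.

Lemma cw_side_not_side i j : cw (side d j) <> side d i.
Proof.
move=> E; case/eqP: (side_rev_neq j (i - 1)%R).
by apply: cI; rewrite E sideS subrK.
Qed.

Lemma bipartite_map_urban_renewal : bipartite_map (urban_renewal d).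
Proof.
have rv (x : {x : dart G | ~~ is_side d x}) : val (insubd x (rev (val x))) = rev (val x).
  by rewrite val_insubd is_side_rev (valP x).
split.
- move=> [x|[[] i]] //=; congr inl; apply: val_inj.
  by rewrite !rv rK.
- pose idx := congr1 (fun x : ur_dart d => if x is inr (_, i) then i else 0%R).
  (* Injectivity of the new [cw] reduces to the old one, since [ur_enter] is injective away from the
     sides. *)
  have enterI y z : (forall i, y <> side d i) -> (forall i, z <> side d i) ->
      ur_enter d y = ur_enter d z -> y = z.
    move=> Ny Nz.
    case: (ur_enterP Ny) => [sy|i ->]; case: (ur_enterP Nz) => [sz|j ->] //; first by case.
    by move/idx=> /= /addIr->.
  (* Among the new darts [ur_enter] reaches only outgoing spokes, whereas [ur_cw] sends the three
     other kinds of new darts to [SpokeIn], [RimFwd] or [RimBwd]. *)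
  have enterN y t i : (forall i, y <> side d i) ->
      ur_enter d y = inr (t, i) -> t = SpokeOut.
    by case/ur_enterP => // j _ [].
  have Nsurv (x : {x : dart G | ~~ is_side d x}) i : cw (val x) <> side d i.
    exact: cw_survivor_not_side (valP x).
  have Nside j i : cw (side d j) <> side d i by apply: cw_side_not_side.
  move=> [x|[[] i]] [y|[[] j]] //=.
  all: try by move/(enterN _ _ _ (Nsurv _)).
  all: try by move/(enterN _ _ _ (Nside _)).
  all: try by move/esym/(enterN _ _ _ (Nsurv _)).
  all: try by move/esym/(enterN _ _ _ (Nside _)).
  + by move/(enterI _ _ (Nsurv _) (Nsurv _))/cI/val_inj->.
  + move/(enterI _ _ (Nsurv _) (Nside _))/cI => E; case/negP: (valP x); rewrite /= E.
    by apply/existsP; exists j; rewrite eqxx.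
  + move/(enterI _ _ (Nside _) (Nsurv _))/cI => E; case/negP: (valP y); rewrite /= -E.
    by apply/existsP; exists i; rewrite eqxx.
  + by move/(enterI _ _ (Nside _) (Nside _))/cI/side_inj->.
  + by move/idx=> /= /addIr->.
  + by move/idx=> /= ->.
  + by move/idx=> /= /addIr->.
- have oE y : (forall i, y <> side d i) -> ur_org (ur_enter d y) = inl (org y).
    by case/ur_enterP => //= i ->; rewrite corner_next.
  move=> [x|[[] i]] /=; rewrite ?subrK ?oE ?oC //.
    by move=> i; apply: cw_survivor_not_side (valP x).
  by move=> j; apply: cw_side_not_side.
- have lE y : (forall i, y <> side d i) -> ur_lface (ur_enter d y) = lface y.
    by case/ur_enterP => //= i ->; rewrite addrK.
  move=> [x|[[] i]] //=; rewrite ?lE ?lC ?rv //.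
    by move=> i; apply: cw_survivor_not_side (valP x).
  by move=> j; apply: cw_side_not_side.
- by move=> [x|[[] i]] /=; rewrite ?rv ?bG ?black_corner_next ?negbK.
Qed.

(** * Arrow counts before and after urban renewal *)

Let a : 'I_4 -> 'I_n := across d.
Let b (p : 'I_4) : bool := black (corner d p).
Let B (f : 'I_n) := \sum_p (b p && (a p == f)).
Let W (f : 'I_n) := \sum_p (~~ b p && (a p == f)).
(** The contribution of the surviving edges, common to both graphs. *)
Let S (i j : 'I_n) := \sum_(x : {x | ~~ is_side d x}) (is_arrow i j (val x) : nat).

Let bS (p : 'I_4) : b (p + 1)%R = ~~ b p. Proof. exact: black_corner_next. Qed.
Let b1 : b 1%R = ~~ b 0%R. Proof. by rewrite -bS add0r. Qed.
Let b2 : b 2%:R%R = b 0%R. Proof. by rewrite mulr2n bS b1 negbK. Qed.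
Let b3 : b 3%:R%R = ~~ b 0%R. Proof. by rewrite mulrSr bS b2. Qed.

(** The eight darts are pairwise different because [side d] is injective and no side is the reverse
    of a side. *)
Lemma sum_sides (F : dart G -> nat) :
  \sum_(x | is_side d x) F x = \sum_p (F (side d p) + F (rev (side d p))).
Proof.
pose h (p : 'I_4 + 'I_4) := match p with inl p => side d p | inr p => rev (side d p) end.
have hI : injective h.
  move=> [p|p] [q|q] /=; first by move/side_inj->.
  - by move=> E; case/eqP: (side_rev_neq p q).
  - by move=> E; case/eqP: (side_rev_neq q p).
  - by move/(bm_rev_inj bmG)/side_inj->.
rewrite (eq_bigl (mem (codom h))) => [|x].
  rewrite -big_uniq ?(map_inj_uniq hI) ?enum_uniq // big_image big_sumType.
  by rewrite big_split.
apply/existsP/codomP=> [[p /orP[]/eqP->]|[[p|p] ->]].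
- by exists (inl p).
- by exists (inr p).
- by exists p; rewrite eqxx.
- by exists p; rewrite eqxx orbT.
Qed.

(** Each side has one dart with a black origin: [side d p], giving an arrow out of [k], if corner
    [p] is black, and its reverse, giving an arrow into [k], otherwise. *)
Lemma arrows_quadrilateral i j :
  arrows G i j = S i j + (k == i) * B j + W i * (k == j).
Proof.
rewrite mxE (sum_subtype (fun x => ~~ is_side d x)) -addnA; congr (_ + _).
under eq_bigl do rewrite negbK.
rewrite sum_sides big_split /= big_distrr big_distrl /=; congr (_ + _);
  apply: eq_bigr => p _; rewrite mulnb /is_arrow.
  by rewrite lface_side andbCA.
by rewrite rK bG lface_side -andbA.
Qed.

(** The spoke at corner [p] separates the faces across sides [p - 1] and [p], and its arrow leads
    from the white index to the black one. In a 4-cycle every white index is next to every black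
    one, so the four spokes run once through all such pairs. *)
Lemma spokesE i j :
  \sum_p ([&& b p, a (p - 1)%R == i & a p == j] +
          [&& ~~ b p, a p == i & a (p - 1)%R == j]) = W i * B j.
Proof.
have s0 : (0 - 1 = 3%:R :> 'I_4)%R by apply: val_inj.
have s1 : (1 - 1 = 0 :> 'I_4)%R by apply: val_inj.
have s2 : (2%:R - 1 = 1 :> 'I_4)%R by apply: val_inj.
have s3 : (3%:R - 1 = 2%:R :> 'I_4)%R by apply: val_inj.
rewrite /W /B !big_ord4 /= s0 s1 s2 s3 b1 b2 b3; case: (b 0%R) => /=;
  rewrite ?add0n ?addn0 ?mulnDl ?mulnDr ?mulnb; lia.
Qed.

(** The rim corners have the opposite colours, hence [W] and [B] trade places in the terms at
    [k]. *)
Lemma arrows_urban_renewal i j :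
  arrows (urban_renewal d) i j = S i j + W i * B j + (k == i) * W j + B i * (k == j).
Proof.
have rv (x : {x : dart G | ~~ is_side d x}) : val (insubd x (rev (val x))) = rev (val x).
  by rewrite val_insubd is_side_rev (valP x).
rewrite mxE big_sumType /= -!addnA; congr (_ + _).
  by apply: eq_bigr => x _; rewrite /is_arrow /= rv.
rewrite -spokesE big_distrr big_distrl /= -!big_split /=.
have pairE (F : new_dart * 'I_4 -> nat) : \sum_x F x = \sum_p \sum_t F (t, p).
  by rewrite exchange_big pair_bigA; apply: eq_bigr => -[].
rewrite pairE; apply: eq_bigr => p _.
rewrite (perm_big [:: SpokeOut; SpokeIn; RimFwd; RimBwd]) /=; last first.
  by apply: uniq_perm; rewrite ?index_enum_uniq //; case; rewrite mem_index_enum.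
rewrite !big_cons big_nil /is_arrow /= addn0 !mulnb black_corner_next negbK.
by rewrite -!addnA; congr (_ + (_ + (_ + _))); rewrite -/k -?andbA 1?andbCA.
Qed.

(** * Comparison with quiver mutation *)

Hypothesis adj : forall p, across d p <> across d (p + 1)%R.
Hypothesis no_loop : forall i, quiver G i i = 0.

(** By [spokesE] the product counts the corners with [f] across both adjacent sides. *)
Let WB0 f : W f * B f = 0.
Proof.
rewrite -spokesE big1 // => p _; have := @adj (p - 1)%R; rewrite subrK -/a.
case: (eqVneq (a p) f) => [->|]; last by rewrite !andbF.
by case: (eqVneq (a (p - 1)%R) f) => [->|]; rewrite ?andbF.
Qed.

(** Diagonal entries pass unchanged through [remove_2cycles], so each summand of the arrow count
    vanishes there. *)
Let loops i : S i i = 0 /\ (k == i) * (B i + W i) = 0.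
Proof.
by have := no_loop i; rewrite quiverE remove_2cyclesE eqxx arrows_quadrilateral; lia.
Qed.

Let Bk : B k = 0. Proof. by have [_] := loops k; rewrite eqxx; lia. Qed.
Let Wk : W k = 0. Proof. by have [_] := loops k; rewrite eqxx; lia. Qed.

Let S0 i j : (i == k) || (j == k) -> S i j = 0.
Proof.
move=> ijk; rewrite /S big1 // => x _; apply/eqP; rewrite eqb0.
apply: contra (valP x) => /and3P[_ /eqP xi /eqP xj]; case/orP: ijk => /eqP E.
  have [|p Ep] := @sideP (val x); first by rewrite xi.
  by apply/existsP; exists p; rewrite -Ep eqxx.
rewrite -is_side_rev; have [|p Ep] := @sideP (rev (val x)); first by rewrite xj.
by apply/existsP; exists p; rewrite -Ep eqxx.
Qed.

(** By [WB0] one of [W i] and [B i] is zero, so the truncated difference [W i - B i] is [W i]. *)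
Lemma quiver_to_quad i : quiver G i k = W i.
Proof.
rewrite quiverE remove_2cyclesE !arrows_quadrilateral eqxx Bk Wk.
have := WB0 i; have [->|ik] := eqVneq i k; first by rewrite S0 ?eqxx ?Bk ?Wk.
by rewrite !S0 ?eqxx ?orbT //; nia.
Qed.

Lemma quiver_from_quad i : quiver G k i = B i.
Proof.
rewrite quiverE remove_2cyclesE !arrows_quadrilateral eqxx Bk Wk.
have := WB0 i; have [<-|ik] := eqVneq k i; first by rewrite S0 ?eqxx ?Bk ?Wk.
by rewrite !S0 ?eqxx ?orbT //; nia.
Qed.

Lemma quiver_urban_renewal : quiver (urban_renewal d) = quiver_mutation k (quiver G).
Proof.
apply/matrixP=> i j; rewrite {1}quiverE remove_2cyclesE quiver_mutationE.
rewrite !arrows_urban_renewal.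
rewrite !quiver_to_quad !quiver_from_quad !(eq_sym k).
have [_|ij] := eqVneq i j.
  rewrite (loops i).1 no_loop WB0 orbb.
  by have [->|] := eqVneq i k; rewrite ?Bk ?Wk ?mul0n ?muln0.
have [Ei|ik] := eqVneq i k; have [Ej|jk] := eqVneq j k; rewrite ?Ei ?Ej /=.
- by rewrite Ei Ej eqxx in ij.
- by rewrite !S0 ?eqxx ?orbT // Bk Wk quiver_to_quad quiver_from_quad; lia.
- by rewrite !S0 ?eqxx ?orbT // Bk Wk quiver_to_quad quiver_from_quad; lia.
(* Away from [k], cancelling 2-cycles before adding the paths through [k] does not change the final
   truncated difference. *)
- rewrite !quiverE !remove_2cyclesE (negPf ij) eq_sym (negPf ij).
  by rewrite !arrows_quadrilateral !(eq_sym k) (negPf ik) (negPf jk); lia.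
Qed.

Lemma quiver_urban_renewal_diag i : quiver (urban_renewal d) i i = 0.
Proof.
rewrite quiver_urban_renewal quiver_mutationE eqxx orbb no_loop.
by rewrite quiver_to_quad quiver_from_quad WB0; case: ifP.
Qed.

(** Colours alternate, so each of the two products in the exchange relation runs over one pair of
    opposite sides; the colour of corner 0 only decides their order. *)
Lemma urban_weightsE (K : fieldType) (A : {ffun 'I_n -> K}) :
  urban_weights d A = (seed_mutation k (A, quiver G)).1.
Proof.
apply/ffunP=> f; rewrite !ffunE -/k; case: eqP => // _; rewrite mulrC; congr (_ * _)%R.
(* Passing from faces to sides counts a face lying across two opposite sides twice, as the arrow
   multiplicities do. *)
have prodE (c : 'I_4 -> bool) :
    (\prod_j A j ^+ (\sum_p (c p && (a p == j))) = \prod_p A (a p) ^+ c p)%R.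
  under eq_bigr do rewrite -prodrXr.
  rewrite exchange_big; apply: eq_bigr => p _ /=.
  rewrite (bigD1 (a p)) //= eqxx andbT big1 ?mulr1 // => j.
  by rewrite eq_sym => /negPf->; rewrite andbF.
have -> : (\prod_j A j ^+ quiver G j k = \prod_p A (a p) ^+ ~~ b p)%R.
  by rewrite -prodE; apply: eq_bigr => j _; rewrite quiver_to_quad.
have -> : (\prod_j A j ^+ quiver G k j = \prod_p A (a p) ^+ b p)%R.
  by rewrite -prodE; apply: eq_bigr => j _; rewrite quiver_from_quad.
rewrite !big_ord4 /=.
rewrite b1 b2 b3; case: (b 0%R); rewrite /= !expr0 !expr1 !mul1r ?mulr1 //.
by rewrite addrC.
Qed.

End Quadrilateral.

Theorem theorem3p4 (n : nat) (K : fieldType) (G : surface_graph n)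
    (A : {ffun 'I_n -> K}) (k : 'I_n) (d : dart G) :
  torus_graph G ->
  bipartite G ->
  (forall i : 'I_n, A i <> 0%R) ->
  ~ has_1cycle (quiver G) ->
  quadrilateral G k ->
  distinct_sides G k ->
  lface d = k ->
  (forall i : 'I_4, across d i <> across d (i + 1)%R) ->
  forall (G' : surface_graph n) (A' : {ffun 'I_n -> K}),
    graph_mutation k G A G' A' ->
    (A', quiver G') = seed_mutation k (A, quiver G).
Proof.
move=> tG bG _ /no_1cycleP Q0 quad dist dk adj G' A' [d' [d'k GG' ->]].
have bmG := torus_graph_bipartite_map tG bG; subst k.
have covered := sideP bmG quad; have side_next_d := side_next bmG quad.
rewrite -d'k in quad dist *.
(* The mutation may number the sides from another side [d']; each of its sides is some [side d q],
   and successors agree. *)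
have adj' p : across d' p <> across d' (p + 1)%R.
  have [|q Eq] := covered (side d' p); first by rewrite lface_side.
  rewrite /across (side_next bmG quad) Eq -side_next_d; exact: adj.
rewrite (urban_weightsE bmG quad dist adj' Q0); congr (_, _).
rewrite -(quiver_urban_renewal bmG quad dist adj' Q0); apply: quiver_shrink_all GG'.
  exact: bipartite_map_urban_renewal.
exact: quiver_urban_renewal_diag.
Qed.
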